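(* Let $n\ge 5$ and $2\le s\le \lfloor \frac{n-1}{2}\rfloor$ be integers, and write $n=\lambda s+\gamma$ with integers $\lambda,\gamma$ and $0\le\gamma<s$. Assume that $n$ is even, $s$ is odd, and $\lambda>\gamma>0$. Then $$\mathrm{diam}(C_n(1,s))=\left\lceil\frac{\lambda}{2}\right\rceil+\frac{s-1}{2}-\left(\min\left(\left\lceil\frac{\gamma}{2}\right\rceil,\left\lceil\frac{s-\gamma+1}{2}\right\rceil\right)-1\right).$$
   Context: For integers $n\ge5$ and $2\le s\le\lfloor\frac{n-1}{2}\rfloor$, the circulant graph $C_n(1,s)$ is the graph with vertex set $\{0,1,\ldots,n-1\}$ in which two distinct vertices $i,j$ are adjacent if and only if $|i-j|_n\in\{1,s\}$, where $|x|_n=\min(|x|,n-|x|)$. The distance between two vertices is the length (number of edges) of a shortest path joining them, and $\mathrm{diam}$ is the maximum distance over all pairs of vertices. *)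

(* Defs.v *)
From mathcomp Require Import all_boot all_order ssralg ssrint.

Set Implicit Arguments.
Unset Strict Implicit.
Unset Printing Implicit Defensive.

Section Graph.
Variables (T : finType) (e : rel T).

(* [x :: p] lists the vertices of a path, so its number of edges is [size p]. *)
Definition is_path (x y : T) (p : seq T) : bool :=
  [&& path e x p, uniq (x :: p) & last x p == y].

(* A path has fewer than #|T| edges, so the range [k < #|T|] loses nothing;
   the default value #|T| is reached only when no path joins x to y. *)
Definition gdist (x y : T) : nat :=
  \big[minn/#|T|]_(k < #|T| | [exists p : k.-tuple T, is_path x y p]) k.

Definition diam : nat := \max_(x : T) \max_(y : T) gdist x y.

End Graph.

(* The subtraction from n is exact for |x| <= n, in particular when x is a
   difference of two elements of 'I_n. *)
Definition cnorm (n : nat) (x : int) : nat := minn `|x| (n - `|x|).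

Definition circulant (n s : nat) : rel 'I_n :=
  fun i j => (i != j) && (cnorm n (i%:Z - j%:Z)%R \in [:: 1; s]).

(* Main.v *)
Require Import Defs.
From mathcomp Require Import all_boot all_order ssralg ssrint.
From mathcomp Require Import ssrnum intdiv zify.

(** Walking [x] signed unit steps and [y] signed steps of length [s] from a
    vertex [i] leads to [i + x + s * y] modulo [n], and the order of the steps
    is irrelevant.  So the distance from [i] to [j] is the least value of
    [|x| + |y|] over the integer points [(x, y)] with [x + s * y = j - i]
    modulo [n], and the diameter is the covering radius, for the l1 norm on
    Z^2, of the lattice L of points with [x + s * y = 0] modulo [n].  From
    [n = lambda * s + gamma] one gets the basis [a = (s, -1)],
    [b = (gamma, lambda)] of L ([lattice_basis]); the reductions in both
    directions are [diam_le_coords] and [diam_ge_coords].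

    Since [n] is even and [s] odd, [lambda] and [gamma] have the same parity,
    and in both parities the ceilings in the formula disappear: it equals
    [max(D1, D2)] with [2 * D1 = lambda + s + 1 - gamma] and
    [2 * D2 = lambda + gamma].  Here [2 * D2] is the l1 norm of [b], and
    [2 * D1] that of [b - a].

    Upper bound ([lattice_cover]): a residue is written [x + s * y] by
    Euclidean division by [s], so [0 <= x < s] and [0 <= y <= lambda].  If
    [x <= gamma], the distances from [(x, y)] to [0] and to [b] add up to
    [2 * D2]; otherwise the distances to [a] and to [b] add up to [2 * D1].
    One of the two is then at most [max(D1, D2)].

    Lower bound: there are points at distance at least [D1], respectively
    [D2], from all of L.  In the coordinates [x + y] and [x - y] the l1 balls
    are axis-parallel squares, with
    - [a] at [(s - 1, s + 1)],
    - [b] at [(lambda + gamma, gamma - lambda)],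
    so the signs of the coefficients of [m * a + k * b] already show on which
    side of a well-chosen square that point lies ([lattice_hole_diff] and
    [lattice_hole_sum]). *)

Import Order.Theory GRing.Theory Num.Theory.

(** * Distances and walks in a finite graph *)

(** Removing the loops of a walk yields a simple path that is no longer, and a
    simple path is short enough to be in the range of the minimum. *)
Lemma gdist_le_walk (T : finType) (e : rel T) (x y : T) (p : seq T) :
  path e x p -> last x p = y -> gdist e x y <= size p.
Proof.
move=> /shortenP [p' e_p' Up' p'p] last_p'.
have sz_p' : size p' <= size p.
  by apply: uniq_leq_size => //; case/andP: Up'.
have lt_p' : size p' < #|T|.
  by have := max_card (mem (x :: p')); rewrite (card_uniqP Up').
rewrite /gdist -minEnat -leEnat.
apply: (@bigmin_inf _ _ _ _ (Ordinal lt_p')); last exact: sz_p'.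
by apply/existsP; exists (in_tuple p'); rewrite /is_path e_p' Up' last_p' eqxx.
Qed.

Lemma gdist_ge_walks (T : finType) (e : rel T) (x y : T) (D : nat) :
  D <= #|T| ->
  (forall p, path e x p -> last x p = y -> D <= size p) -> D <= gdist e x y.
Proof.
move=> leDT walks; rewrite /gdist.
apply: (big_ind (fun k => D <= k)) => // [a b Da Db | k].
  by rewrite leq_min Da.
by case/existsP=> p /and3P[e_p _ /eqP last_p]; rewrite -(size_tuple p) walks.
Qed.

Local Open Scope ring_scope.

(** * Walks in the circulant graph and integer coordinates *)

Lemma circulant_step (n s : nat) (i j : 'I_n) (d q : int) :
  (1 <= s)%N -> (s.*2 < n)%N -> (`|d| == 1)%N || (`|d| == s)%N ->
  j%:Z = i%:Z + d + q * n%:Z -> circulant s i j.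
Proof.
move=> s_gt0 s2n hd hj; have ltin := ltn_ord i; have ltjn := ltn_ord j.
(* Both j - i and d are less than n in absolute value. *)
have hq : q = -1 \/ q = 0 \/ q = 1 by nia.
have hdn : (0 < `|d| <= s)%N by lia.
rewrite /circulant /cnorm -val_eqE !inE /=.
by move: hj; case: hq => [->|[->|->]] hj; lia.
Qed.

Lemma circulant_diff (n s : nat) (i j : 'I_n) :
  circulant s i j ->
  exists d q : int,
    ((`|d| == 1)%N || (`|d| == s)%N) /\ j%:Z = i%:Z + d + q * n%:Z.
Proof.
have ltin := ltn_ord i; have ltjn := ltn_ord j.
rewrite /circulant /cnorm !inE => /andP[_].
(* When going around through 0 is shorter, the signed step differs from j - i
   by n, with a sign that depends on which endpoint is larger. *)
case: (leqP `|i%:Z - j%:Z| (n - `|i%:Z - j%:Z|)) => _ hd.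
  by exists (j%:Z - i%:Z), 0; lia.
case: (leqP i j) => leij.
  by exists (j%:Z - i%:Z - n%:Z), 1; lia.
by exists (j%:Z - i%:Z + n%:Z), (-1); lia.
Qed.

Lemma ord_mod (n : nat) (z : int) :
  (0 < n)%N -> exists (j : 'I_n) (q : int), j%:Z = z + q * n%:Z.
Proof.
move=> n_gt0; have nz : n%:Z != 0 by lia.
have ge0 := modz_ge0 z nz; have lt := ltz_pmod z (d := n%:Z) n_gt0.
have ltj : (`|(z %% n%:Z)%Z| < n)%N by lia.
exists (Ordinal ltj), (- (z %/ n%:Z)%Z) => /=.
by have := divz_eq z n%:Z; lia.
Qed.

(** Each step brings one nonzero coordinate closer to 0 by one.  The statement allows any multiple of [n] because intermediate
    vertices are reduced modulo [n]. *)
Lemma walk_of_coords (n s : nat) (x y q : int) (i j : 'I_n) :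
  (1 <= s)%N -> (s.*2 < n)%N ->
  j%:Z = i%:Z + x + s%:Z * y + q * n%:Z ->
  exists p, [/\ path (@circulant n s) i p, last i p = j
              & size p = (`|x| + `|y|)%N].
Proof.
move=> s_gt0 s2n; have n_gt0 : (0 < n)%N by lia.
move def_k: (`|x| + `|y|)%N => k.
elim: k x y q i def_k => [|k IHk] x y q i def_k hj.
  exists [::]; split=> //=; apply/val_inj => /=.
  have [x0 y0] : x = 0 /\ y = 0 by lia.
  have ltin := ltn_ord i; have ltjn := ltn_ord j.
  move: hj; rewrite x0 y0 mulr0 !addr0 => hj.
  have q0 : q = 0 by nia.
  by move: hj; rewrite q0; lia.
have [d [x' [y' [hd def_k' hxy]]]] : exists (d x' y' : int),
    [/\ (`|d| == 1)%N || (`|d| == s)%N, (`|x'| + `|y'|)%N = k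
      & x + s%:Z * y = d + x' + s%:Z * y'].
  have [x_gt0|x_lt0|x0] := ltrgtP 0 x.
  - by exists 1, (x - 1), y; split; lia.
  - by exists (-1), (x + 1), y; split; lia.
  have [y_gt0|y_lt0|y0] := ltrgtP 0 y.
  - by exists s%:Z, x, (y - 1); split; lia.
  - by exists (- s%:Z), x, (y + 1); split; lia.
  by lia.
have [i' [q' hi']] := @ord_mod n (i%:Z + d) n_gt0.
have [|p [e_p last_p sz_p]] := IHk x' y' (q - q') i' def_k'.
  by rewrite hj hi'; lia.
exists (i' :: p); split=> //=; last by rewrite sz_p.
by rewrite e_p andbT; apply: circulant_step hi'.
Qed.

Lemma coords_of_walk (n s : nat) (i : 'I_n) (p : seq 'I_n) :
  path (@circulant n s) i p ->
  exists x y q : int, (`|x| + `|y| <= size p)%N /\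
    (last i p)%:Z = i%:Z + x + s%:Z * y + q * n%:Z.
Proof.
elim: p i => [|i' p IHp] i /=; first by exists 0, 0, 0; lia.
case/andP=> /circulant_diff[d [q' [hd hi']]] /IHp[x [y [q [szp ->]]]].
case/orP: hd => hd.
  by exists (x + d), y, (q + q'); lia.
have hds : d = s%:Z \/ d = - s%:Z by lia.
by case: hds => hds; [exists x, (y + 1) | exists x, (y - 1)];
   exists (q + q'); lia.
Qed.

(** By rotation invariance it suffices to reach every residue from 0. *)
Lemma diam_le_coords (n s D : nat) :
  (1 <= s)%N -> (s.*2 < n)%N ->
  (forall v : nat, (v < n)%N -> exists x y q : int,
     (`|x| + `|y| <= D)%N /\ v%:Z = x + s%:Z * y + q * n%:Z) ->
  (diam (@circulant n s) <= D)%N.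
Proof.
move=> s_gt0 s2n hcov; apply/bigmax_leqP=> i _; apply/bigmax_leqP=> j _.
have n_gt0 : (0 < n)%N by lia.
have [v [q hv]] := @ord_mod n (j%:Z - i%:Z) n_gt0.
have [x [y [q' [leD hxy]]]] := hcov v (ltn_ord v).
have [|p [e_p last_p sz_p]] :=
  @walk_of_coords n s x y (q' - q) i j s_gt0 s2n.
  by lia.
by rewrite (leq_trans (gdist_le_walk _ _ _ _ _ e_p last_p)) // sz_p.
Qed.

(** The point [(hx, hy)] is meant to be a deep hole of the lattice: the pairs
    [(x, y)] are its differences with the lattice points. *)
Lemma diam_ge_coords (n s D : nat) (hx hy : int) :
  (0 < n)%N -> (D <= n)%N ->
  (forall x y q : int, x + s%:Z * y = hx + s%:Z * hy + q * n%:Z ->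
     (D <= `|x| + `|y|)%N) ->
  (D <= diam (@circulant n s))%N.
Proof.
move=> n_gt0 leDn far.
have [i [q1 hi]] := @ord_mod n 0 n_gt0.
have [j [q2 hj]] := @ord_mod n (hx + s%:Z * hy) n_gt0.
apply: leq_trans (leq_bigmax (F := fun x => \max_y gdist (circulant s) x y) i).
apply: leq_trans (leq_bigmax (F := fun y => gdist (circulant s) i y) j).
apply: gdist_ge_walks => [|p e_p last_p]; first by rewrite card_ord.
have [x [y [q [le_p hxy]]]] := coords_of_walk _ _ _ _ e_p.
apply: leq_trans le_p; apply: (far x y (q2 - q1 - q)).
by move: hxy; rewrite last_p hj hi; lia.
Qed.

(** * The lattice of the relations x + s y = 0 modulo n *)

Section Lattice.

Variables n s lambda gamma : nat.
Hypothesis n_def : n = (lambda * s + gamma)%N.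
Hypothesis s_gt0 : (0 < s)%N.

(** In terms of [a = (s, -1)] and [b = (gamma, lambda)] the point is
    [m * a + q * b]: both basis vectors are in the lattice, [x + s * y] being
    [0] on [a] and [n] on [b], so [q] is forced, and [m] is read off [Y]. *)
Lemma lattice_basis (X Y q : int) :
  X + s%:Z * Y = q * n%:Z ->
  exists m : int, X = m * s%:Z + q * gamma%:Z /\ Y = q * lambda%:Z - m.
Proof. by move=> hXY; exists (q * lambda%:Z - Y); split; lia. Qed.

(** The two size hypotheses on [D] say that it is at least [D1] and [D2].  The
    representations tried are the differences between [(x, y)] and [0], [a]
    or [b]; on each side of [x = gamma], two of them have norms with sum at
    most [2 * D], so that one of these two fits. *)
Lemma lattice_cover (D v : nat) :
  (gamma < s)%N ->
  (lambda + s + 1 <= D.*2 + gamma)%N -> (lambda + gamma <= D.*2)%N ->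
  (v < n)%N ->
  exists x y q : int,
    (`|x| + `|y| <= D)%N /\ v%:Z = x + s%:Z * y + q * n%:Z.
Proof.
move=> lt_gs leD1 leD2 lt_vn.
have hv := divn_eq v s; have lt_xs := ltn_pmod v s_gt0.
move: hv lt_xs; set y := (v %/ s)%N; set x := (v %% s)%N => hv lt_xs.
(* The extreme value y = lambda occurs, but only with x < gamma. *)
have le_y : (y <= lambda)%N by nia.
have [le_xg|lt_gx] := leqP x gamma.
  have [le1|gt1] := leqP (x + y) D.
    by exists x%:Z, y%:Z, 0; lia.
  by exists (x%:Z - gamma%:Z), (y%:Z - lambda%:Z), 1; lia.
have [le1|gt1] := leqP (s - x + (y + 1)) D.
  by exists (x%:Z - s%:Z), (y%:Z + 1), 0; lia.
by exists (x%:Z - gamma%:Z), (y%:Z - lambda%:Z), 1; lia.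
Qed.

(** The hole is [((s + 1) / 2, (lambda - gamma) / 2)] and its radius is
    [D1 = r + t + 1].  The open square around it is the region
    [0 < x + y < 2 * D1], [gamma - lambda < x - y < s + 1]: it has [b] and [a]
    on the two sides that bound [x - y], and [0] on the side [x + y = 0].  A
    lattice point [m * a + k * b] with one coefficient [>= 1] and the other
    [<= 0] is excluded by [x - y]; one with [m, k <= 0] is excluded by [x + y];
    if [m, k >= 1] then [x + y >= s - 1 + lambda + gamma >= 2 * D1], the last
    inequality because [gamma > 0]. *)
Lemma lattice_hole_diff (t r : nat) (x y q : int) :
  s = t.*2.+1 -> lambda = (r.*2 + gamma)%N -> (0 < gamma)%N ->
  x + s%:Z * y = t.+1%:Z + s%:Z * r%:Z + q * n%:Z ->
  (r + t + 1 <= `|x| + `|y|)%N.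
Proof.
move=> def_s def_l g_gt0 hxy.
have [|m [hX hY]] := @lattice_basis (t.+1%:Z - x) (r%:Z - y) (- q).
  by lia.
move: hX hY; move: (- q) => k hX hY.
have {hX} hx : x = t.+1%:Z - m * s%:Z - k * gamma%:Z by lia.
have {hY} hy : y = r%:Z + m - k * lambda%:Z by lia.
have [m_gt0|m_le0] := ltP 0 m; have [k_gt0|k_le0] := ltP 0 k.
- have : (r + t + 1)%:Z <= - (x + y) by nia.
  by lia.
- have : (r + t + 1)%:Z <= y - x by nia.
  by lia.
- have : (r + t + 1)%:Z <= x - y by nia.
  by lia.
have : (r + t + 1)%:Z <= x + y by nia.
by lia.
Qed.

(** The hole is [((s + 1) / 2, (lambda + gamma - s - 1) / 2)] and its radius is
    [D2 = r + gamma].  The open square around it is the region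
    [0 < x + y < lambda + gamma], with [0] and [b] on the sides that bound
    [x + y], and [s + 1 - 2 * D2 < x - y < s + 1], with [a] on a side.  A
    lattice point [m * a + k * b] is excluded by [x + y] when [m >= 0] and
    [k >= 1], and when [m, k <= 0].  If [m >= 1] and [k <= 0] then [x - y >= s + 1]; if
    [m <= -1] and [k >= 1] then [x - y] is at most its value at [b - a], which
    is at most [s + 1 - 2 * D2] because [gamma < s]. *)
Lemma lattice_hole_sum (t r : nat) (x y q : int) :
  s = t.*2.+1 -> lambda = (r.*2 + gamma)%N -> (gamma < s)%N ->
  x + s%:Z * y
    = t.+1%:Z + s%:Z * (r%:Z + gamma%:Z - t.+1%:Z) + q * n%:Z ->
  (r + gamma <= `|x| + `|y|)%N.
Proof.
move=> def_s def_l lt_gs hxy.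
have [|m [hX hY]] :=
  @lattice_basis (t.+1%:Z - x) (r%:Z + gamma%:Z - t.+1%:Z - y) (- q).
  by lia.
move: hX hY; move: (- q) => k hX hY.
have {hX} hx : x = t.+1%:Z - m * s%:Z - k * gamma%:Z by lia.
have {hY} hy : y = r%:Z + gamma%:Z - t.+1%:Z + m - k * lambda%:Z by lia.
(* Twice pk and twice pm are the contributions of the two coefficients to the
   amount by which m a + k b lies further from the hole, in the deciding
   coordinate, than the nearest point allowed by the signs of m and k. *)
have [k_gt0|k_le0] := ltP 0 k; last have [m_gt0|m_le0] := ltP 0 m.
- have k1 : 0 <= k - 1 by lia.
  have [m_ge0|m_lt0] := leP 0 m.
    have pk := mulr_ge0 k1 (ler0n _ (r + gamma)).
    have pm := mulr_ge0 m_ge0 (ler0n _ t).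
    by rewrite def_s def_l in hx hy; lia.
  have m1 : 0 <= - m - 1 by lia.
  have pk := mulr_ge0 k1 (ler0n _ r).
  have pm := mulr_ge0 m1 (ler0n _ t.+1).
  by rewrite def_s def_l in hx hy; lia.
- have m1 : 0 <= m - 1 by lia.
  have k1 : 0 <= - k by lia.
  have pk := mulr_ge0 k1 (ler0n _ r).
  have pm := mulr_ge0 m1 (ler0n _ t.+1).
  by rewrite def_s def_l in hx hy; lia.
have k1 : 0 <= - k by lia.
have m1 : 0 <= - m by lia.
have pk := mulr_ge0 k1 (ler0n _ (r + gamma)).
have pm := mulr_ge0 m1 (ler0n _ t).
by rewrite def_s def_l in hx hy; lia.
Qed.

End Lattice.

Local Close Scope ring_scope.

(** * The diameter *)

(* [uphalf m] is the ceiling of m / 2. Under the hypotheses every natural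
   number subtraction below is exact. *)
Theorem theorem3p4 (n s lambda gamma : nat)
  (hn : 5 <= n) (hs2 : 2 <= s) (hsn : s <= (n - 1)./2)
  (hdiv : n = lambda * s + gamma) (hgs : gamma < s)
  (hn_even : ~~ odd n) (hs_odd : odd s)
  (hg0 : 0 < gamma) (hgl : gamma < lambda) :
  diam (@circulant n s) =
    uphalf lambda + (s - 1)./2
    - (minn (uphalf gamma) (uphalf (s - gamma + 1)) - 1).
Proof.
have s_gt0 : 0 < s by lia.
have n_gt0 : 0 < n by lia.
have s2n : s.*2 < n by lia.
have [t def_s] : exists t, s = t.*2.+1 by exists s./2; lia.
(* lambda and gamma have the same parity, since n is even and s is odd. *)
have [r def_l] : exists r, lambda = r.*2 + gamma.
  exists (lambda - gamma)./2.
  have : ~~ odd (lambda - gamma).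
    move: hn_even; rewrite hdiv oddD oddM hs_odd andbT oddB ?(ltnW hgl) //.
  by lia.
have -> : uphalf lambda + (s - 1)./2
    - (minn (uphalf gamma) (uphalf (s - gamma + 1)) - 1)
    = maxn (r + t + 1) (r + gamma).
  by rewrite !uphalf_half; lia.
apply/eqP; rewrite eqn_leq geq_max; apply/and3P; split.
- apply: diam_le_coords => // v; apply: (lattice_cover _ _ _ _ hdiv) => //; lia.
- apply: (diam_ge_coords _ _ _ t.+1%:Z r%:Z) => // [|x y q]; first by nia.
  exact: (lattice_hole_diff _ _ _ _ hdiv).
apply: (diam_ge_coords _ _ _ t.+1%:Z (r%:Z + gamma%:Z - t.+1%:Z)%R)
  => // [|x y q]; first by nia.
exact: (lattice_hole_sum _ _ _ _ hdiv).
Qed.
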